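(* Let $(\Omega,\mathcal F)$ be a measurable space with a filtration $\{\mathcal F_m\}_{m=0}^\infty$, $\mathcal F_0=\{\emptyset,\Omega\}$, and let $M$ be a convex set of equivalent measures on $\mathcal F$. Let $\{f_m,\mathcal F_m\}_{m=0}^\infty$ be a supermartingale relative to $M$ belonging to the class $F$, i.e. $\sup_{P\in M}E^P|f_m|<\infty$ for all $m\ge 0$, for which the representation $$f_m=M_m-g_m^0,\qquad m=0,1,2,\dots,$$ is valid, where $\{M_m\}_{m=0}^\infty$ is a martingale relative to $M$ with $E^P|M_m|<\infty$ for all $m\ge0$, $P\in M$, and $g^0=\{g_m^0\}_{m=0}^\infty$, $g_0^0=0$, is a non-decreasing adapted process. Then $\{f_m,\mathcal F_m\}_{m=0}^\infty$ is a local regular supermartingale.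
   Context: Setting. $(\Omega,\mathcal F)$ is a measurable space with filtration $\mathcal F_m\subset\mathcal F_{m+1}\subset\mathcal F$, $m=0,1,2,\dots$, $\mathcal F_0=\{\emptyset,\Omega\}$. $M$ is a convex set of mutually equivalent probability measures on $\mathcal F$; $E^P$ is expectation under $P$. A process $\{\psi_m\}$ is adapted if $\psi_m$ is $\mathcal F_m$-measurable for all $m$. An adapted process $\{f_m\}$ is a supermartingale relative to $M$ if $E^P|f_m|<\infty$ for $m\ge 1$, $P\in M$, and $E^P\{f_m|\mathcal F_k\}\le f_k$ for $0\le k\le m$, $P\in M$; it is a martingale relative to $M$ if equality holds. Regular supermartingale. Let $\{f_m,\mathcal F_m\}$ be a supermartingale relative to $M$ for which there are a random variable $\varphi$ and a real $T$ with ( * ) $|f_m|\le\varphi$ for all $m\ge 0$ and $E^Q\varphi<T<\infty$ for all $Q\in M$ ($T$ not depending on $Q$). For $\hat P_1,\dots,\hat P_s\in M$ put $\hat M_s=\{\sum_{i=1}^s\gamma_i\hat P_i:\gamma_i\ge0,\sum_i\gamma_i=1\}$ and let $G_s$ be the set of adapted non-decreasing processes $g=\{g_m\}_{m=0}^\infty$, $g_0=0$, such that $\{f_m+g_m\}$ is a supermartingale relative to all measures in $\hat M_s$. Processes are partially ordered by $g^1\preceq g^2$ iff $g^1_m\le g^2_m$ almost surely for all $m$; a maximal chain is a totally ordered subset maximal under inclusion. The supermartingale is called regular if for every finite family $\hat P_1,\dots,\hat P_s\in M$ satisfying $0<l\le \frac{d\hat P_i}{d\hat P_j}\le L<\infty$,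 $i,j=1,\dots,s$ (with real $l,L$ depending on the family): (i) there exist $1\le m_0<\infty$ and an $\mathcal F_{m_0-1}$-measurable nonnegative random variable $\varphi_{m_0}^s$ with $\hat P_1(\varphi_{m_0}^s>0)>0$ such that $f_{m_0-1}-E^{\hat P_i}\{f_{m_0}|\mathcal F_{m_0-1}\}\ge\varphi_{m_0}^s$, $i=1,\dots,s$; (ii) for the maximal element $g^s=\{g^s_m\}$ in a certain maximal chain $\tilde G_s\subseteq G_s$, $E^{\hat P_i}\{f_m+g^s_m|\mathcal F_k\}=f_k+g_k^s$ for $0\le k\le m$, $m\ge1$, $i=1,\dots,s$; and moreover (iii) there exists an adapted nonnegative process $\bar g^0=\{\bar g^0_m\}_{m=0}^\infty$, $\bar g^0_0=0$, $E^P\bar g_m^0<\infty$ for $m\ge1$, $P\in M$, not depending on the family $\hat P_1,\dots,\hat P_s$, such that $E^{\hat P_i}\{g_m^s-g_{m-1}^s|\mathcal F_{m-1}\}=E^{\hat P_i}\{\bar g^0_m|\mathcal F_{m-1}\}$ for $m\ge1$, $i=1,\dots,s$. Local regular supermartingale. A supermartingale $f\in F$ (i.e. $\sup_{P\in M}E^P|f_m|<\infty$ for all $m\ge0$) is local regular if there is an increasing sequence of nonrandom times $\tau_{k_s}=k_s<\infty$, $k_s\to\infty$ as $s\to\infty$, such that for every $s$ the stopped process $\{f_{m\wedge k_s},\mathcal F_m\}_{m=0}^\infty$ is a regular supermartingale relative to $M$.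
   Formalization: The formal theorem also assumes that f is not itself a martingale relative to M (g^0 is not almost surely zero, M nonempty), because a martingale violates condition (i) of regularity and is never local regular. *)

(* Defs.v *)
From HB Require Import structures.
From mathcomp Require Import all_boot all_order all_algebra.
From mathcomp Require Import all_classical all_reals all_analysis.
Set Implicit Arguments.
Unset Strict Implicit.
Unset Printing Implicit Defensive.
Import Order.TTheory GRing.Theory Num.Theory.
Import numFieldNormedType.Exports.
Local Open Scope classical_set_scope.
Local Open Scope charge_scope.
Local Open Scope ring_scope.

Section Defs.
Context (d : measure_display) (T : measurableType d) (R : realType).

(* Measures of type [probability T R] may differ outside the measurable sets,
   so mixtures are compared on measurable sets only. *)
Definition is_mixture (n : nat) (c : 'I_n -> R) (Q : 'I_n -> probability T R)
    (P : probability T R) : Prop :=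
  [/\ forall i, 0 <= c i, \sum_(i < n) c i = 1
    & forall A, measurable A -> P A = (\sum_(i < n) (c i)%:E * Q i A)%E].

Definition mixtures (n : nat) (Q : 'I_n -> probability T R) :
    set (probability T R) :=
  [set P | exists c, is_mixture c Q P].

Definition convex_family (M : set (probability T R)) : Prop :=
  forall P Q (t : R), M P -> M Q -> 0 <= t <= 1 ->
  exists2 N, M N &
    forall A, measurable A -> N A = (t%:E * P A + (1 - t)%:E * Q A)%E.

Definition equivalent_family (M : set (probability T R)) : Prop :=
  forall P Q, M P -> M Q -> P `<< Q.

(* Equalities and inequalities between random variables are understood almost
   surely, for every measure of the family under consideration. *)
Definition as_family (M : set (probability T R)) (A : T -> Prop) : Prop :=
  forall P, M P -> \forall w \ae P, A w.

Definition is_filtration (F : nat -> set (set T)) : Prop :=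
  [/\ F 0%N = [set set0; setT],
      forall m, sigma_algebra setT (F m),
      forall m, F m `<=` F m.+1
    & forall m, F m `<=` measurable].

Definition measurable_wrt (G : set (set T)) (X : T -> R) : Prop :=
  measurable_fun [set: g_sigma_algebraType G] X.

Definition adapted (F : nat -> set (set T)) (f : nat -> T -> R) : Prop :=
  forall m, measurable_wrt (F m) (f m).

(* [Y] is a version of the conditional expectation E^P{X | G}. *)
Definition is_condE (P : probability T R) (G : set (set T)) (X Y : T -> R) :
    Prop :=
  [/\ P.-integrable setT (EFin \o X),
      P.-integrable setT (EFin \o Y),
      measurable_wrt G Y
    & forall A, G A ->
        (\int[P]_(w in A) (Y w)%:E = \int[P]_(w in A) (X w)%:E)%E].

Definition is_supermartingale (F : nat -> set (set T))
    (M : set (probability T R)) (f : nat -> T -> R) : Prop :=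
  [/\ adapted F f,
      forall P, M P -> forall m, (1 <= m)%N ->
        ('E_P[fun w => `|f m w|%R] < +oo)%E
    & forall P, M P -> forall k m, (k <= m)%N ->
        exists2 Y, is_condE P (F k) (f m) Y & \forall w \ae P, Y w <= f k w].

(* As [f k] is (F k)-measurable, the almost sure equality of E^P{f_m | F_k}
   and f_k says that [f k] is itself a version. *)
Definition is_martingale (F : nat -> set (set T))
    (M : set (probability T R)) (f : nat -> T -> R) : Prop :=
  [/\ adapted F f,
      forall P, M P -> forall m, (1 <= m)%N ->
        ('E_P[fun w => `|f m w|%R] < +oo)%E
    & forall P, M P -> forall k m, (k <= m)%N ->
        is_condE P (F k) (f m) (f k)].

Definition class_F (M : set (probability T R)) (f : nat -> T -> R) : Prop :=
  forall m,
    (ereal_sup [set 'E_P[fun w => `|f m w|%R] | P in M] < +oo)%E.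

Definition nondecreasing_process (F : nat -> set (set T))
    (M : set (probability T R)) (g : nat -> T -> R) : Prop :=
  [/\ adapted F g, forall w, g 0%N w = 0
    & as_family M (fun w => nondecreasing_seq (fun m => g m w))].

Definition compensators (F : nat -> set (set T)) (N : set (probability T R))
    (f : nat -> T -> R) : set (nat -> T -> R) :=
  [set g | nondecreasing_process F N g /\
           is_supermartingale F N (fun m w => f m w + g m w)].

Definition process_le (N : set (probability T R)) (g h : nat -> T -> R) :
    Prop :=
  forall m, as_family N (fun w => g m w <= h m w).

Definition maximal_chain (U : Type) (le : U -> U -> Prop) (G C : set U) :
    Prop :=
  [/\ C `<=` G, total_on C le
    & forall D, D `<=` G -> total_on D le -> C `<=` D -> D = C].

Definition maximal_element (U : Type) (le : U -> U -> Prop) (C : set U)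
    (x : U) : Prop :=
  C x /\ forall y, C y -> le x y -> le y x.

Definition bounded_densities (n : nat) (Q : 'I_n -> probability T R) : Prop :=
  exists l L : R, 0 < l /\ forall i j, \forall w \ae Q j,
    (l%:E <= ('d (charge_of_finite_measure (Q i)) '/d (Q j)) w <= L%:E)%E.

(* The family P_1, ..., P_s is [Q : 'I_n.+1 -> _] with s = n.+1, P_1 = Q ord0.
   The condition on [phi] fails when [f] is a martingale: a martingale relative
   to a nonempty family is never regular, nor local regular. *)
Definition is_regular (F : nat -> set (set T)) (M : set (probability T R))
    (f : nat -> T -> R) : Prop :=
  [/\ is_supermartingale F M f,
      exists (phi : T -> R) (C : R),
        [/\ measurable_fun setT phi,
            forall m, as_family M (fun w => `|f m w| <= phi w)
          & forall P, M P -> ('E_P[phi] < C%:E)%E]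
    & exists gbar : nat -> T -> R,
      [/\ adapted F gbar,
          forall w, gbar 0%N w = 0,
          forall m, as_family M (fun w => 0 <= gbar m w),
          forall P, M P -> forall m, (1 <= m)%N -> ('E_P[gbar m] < +oo)%E
        & forall (n : nat) (Q : 'I_n.+1 -> probability T R),
          (forall i, M (Q i)) -> bounded_densities Q ->
          (exists (m0 : nat) (phi : T -> R),
            [/\ (1 <= m0)%N,
                measurable_wrt (F m0.-1) phi,
                as_family M (fun w => 0 <= phi w),
                (0 < Q ord0 [set w | (0 < phi w)%R])%E
              & forall i, exists2 Y, is_condE (Q i) (F m0.-1) (f m0) Y &
                  \forall w \ae Q i, phi w <= f m0.-1 w - Y w])
          /\
          (exists (G : set (nat -> T -> R)) (g : nat -> T -> R),
            [/\ maximal_chain (process_le (mixtures Q))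
                  (compensators F (mixtures Q) f) G,
                maximal_element (process_le (mixtures Q)) G g,
                forall i k m, (k <= m)%N -> (1 <= m)%N ->
                  is_condE (Q i) (F k) (fun w => f m w + g m w)
                    (fun w => f k w + g k w)
              & forall i m, (1 <= m)%N -> exists2 Y,
                  is_condE (Q i) (F m.-1) (fun w => g m w - g m.-1 w) Y &
                  is_condE (Q i) (F m.-1) (gbar m) Y])]].

Definition is_local_regular (F : nat -> set (set T))
    (M : set (probability T R)) (f : nat -> T -> R) : Prop :=
  [/\ is_supermartingale F M f, class_F M f
    & exists tau : nat -> nat,
      [/\ {homo tau : s t / (s < t)%N},
          tau s @[s --> \oo] --> \oo
        & forall s, is_regular F M (fun m => f (minn m (tau s)))]].

End Defs.

(* Main.v *)
(* Stop f, its martingale part and g0 at k_s = m0 + s, where m0 >= 1 is a time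
   at which g0 has an increment that does not vanish almost surely.  With g the
   stopped g0, f + g is a martingale for every measure of M, so g is the maximal
   element of any maximal chain of compensators through it, its increments serve
   as the process gbar, and the conditional expectations of the increment at m0
   under finitely many equivalent measures have a common nonzero lower bound. *)
Require Import Defs.
From HB Require Import structures.
From mathcomp Require Import all_boot all_order all_algebra.
From mathcomp Require Import all_classical all_reals all_analysis.
From mathcomp Require Import measurable_realfun.
Set Implicit Arguments.
Unset Strict Implicit.
Unset Printing Implicit Defensive.
Import Order.TTheory GRing.Theory Num.Theory.
Import numFieldNormedType.Exports.
Local Open Scope classical_set_scope.
Local Open Scope ring_scope.

(** * Extending a chain to a maximal chain *)

(** Zorn's lemma is applied to the sets [D] whose union with [C0] is a chain in [G]. Building [C0]
    into the condition makes the empty union admissible. *)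
Lemma chain_sub_maximal_chain (U : Type) (le : U -> U -> Prop) (G C0 : set U) :
  C0 `<=` G -> total_on C0 le -> exists2 C, maximal_chain le G C & C0 `<=` C.
Proof.
move=> C0G C0le.
pose chain (D : set U) := D `|` C0 `<=` G /\ total_on (D `|` C0) le.
have [K KP Ktot|A [[AG Ale] maxA]] := @Zorn_bigcup U chain.
  split=> [x [[D KD Dx]|]|x y]; last 2 first.
  - exact: C0G.
  - move=> [[D KD Dx]|x0] [[E KE Ey]|y0].
    + have [DE|ED] := Ktot _ _ KD KE.
        by apply: (KP E KE).2; left => //; exact: DE.
      by apply: (KP D KD).2; left => //; exact: ED.
    + by apply: (KP D KD).2; [left|right].
    + by apply: (KP E KE).2; [right|left].
    + exact: C0le.
  by apply: (KP D KD).1; left.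
(* Otherwise the union of [A] and [C0] would be a strictly larger admissible set. *)
have C0A : C0 `<=` A.
  apply: contrapT => C0A; apply: (maxA (A `|` C0)).
    by split=> [|AU]; [exact: subsetUl|apply: C0A => x C0x; apply: AU; right].
  by rewrite /chain -setUA setUid.
have AE : A `|` C0 = A by apply/setUidPl.
exists A => //; rewrite AE in AG Ale; split=> // D DG Dle AD.
have DE : D `|` C0 = D by apply/setUidPl; exact: subset_trans AD.
apply: contrapT => DA; apply: (maxA D); last by rewrite /chain DE.
by split=> // DA'; apply: DA; exact/seteqP.
Qed.

(** * Measurability with respect to a sub-sigma-algebra *)

Section measurable_wrt.
Context (d : measure_display) (T : measurableType d) (R : realType).
Implicit Types (G H : set (set T)) (X Y : T -> R).

Lemma measurable_wrtS G H X :
  G `<=` H -> measurable_wrt G X -> measurable_wrt H X.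
Proof.
move=> GH mX _ B mB; have := mX measurableT B mB.
exact: sub_smallest2r.
Qed.

Lemma measurable_wrt_fun G X :
  G `<=` measurable -> measurable_wrt G X -> measurable_fun setT X.
Proof.
move=> Gm mX _ B mB; have := mX measurableT B mB.
apply: smallest_sub => //; exact: sigma_algebra_measurable.
Qed.

End measurable_wrt.

(** * Almost sure properties and signs of integrals *)

Section probability.
Context (d : measure_display) (T : measurableType d) (R : realType).
Implicit Types (P Q : probability T R) (X Y : T -> R) (A : T -> Prop).

Lemma ae_dominates P Q A :
  P `<< Q -> (\forall w \ae Q, A w) -> \forall w \ae P, A w.
Proof.
move=> /null_content_dominatesP PQ [B [mB B0 AB]].
by exists B; split=> //; exact: PQ.
Qed.

Lemma ae_all_ord P n (A : 'I_n -> T -> Prop) :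
  (forall i, \forall w \ae P, A i w) -> \forall w \ae P, forall i, A i w.
Proof.
move=> PA.
(* Indexing by all naturals, vacuously from [n] on, reduces the claim to a countable
   intersection. *)
have : \forall w \ae P, forall k (kn : (k < n)%N), A (Ordinal kn) w.
  apply: ae_foralln => k; have [kn|nk] := pselect (k < n)%N.
    by apply: filterS (PA (Ordinal kn)) => w Aw kn'; rewrite (bool_irrelevance kn' kn).
  by apply: aeW => w kn; case: (nk kn).
by apply: filterS => w Aw [k kn]; exact: Aw.
Qed.

Lemma ae_integrable P X Y : measurable_fun setT Y ->
  (\forall w \ae P, X w = Y w) -> P.-integrable setT (EFin \o X) ->
  P.-integrable setT (EFin \o Y).
Proof.
move=> mY XY /integrableP[mX iX]; apply/integrableP; split.
  exact/measurable_EFinP.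
rewrite (_ : (\int[P]_w _ = \int[P]_w `|(EFin \o X) w|)%E)//.
apply: ae_eq_integral => //.
- by apply: measurableT_comp => //; exact/measurable_EFinP.
- exact: measurableT_comp.
- by apply: filterS XY => w /= -> _.
Qed.

Lemma expectation_abs_lty P X :
  P.-integrable setT (EFin \o X) -> ('E_P[fun w => `|X w|%R] < +oo)%E.
Proof. by move=> /integrableP[_]; rewrite unlock. Qed.

Lemma integral_abs_ae_ge0 P (D : set T) X : measurable D ->
  measurable_fun setT X -> (\forall w \ae P, 0 <= X w) ->
  (\int[P]_(w in D) (X w)%:E = \int[P]_(w in D) `|(X w)%:E|)%E.
Proof.
move=> mD mX X0.
have mX' : measurable_fun D (EFin \o X).
  by apply/measurable_EFinP; exact: measurable_funTS.
apply: ae_eq_integral => //; first exact: measurableT_comp.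
by apply: filterS X0 => w X0 _; rewrite gee0_abs// lee_fin.
Qed.

(** Integrability of [X] is not assumed: on [D] it agrees almost surely with [-|X|], whose integral
    always makes sense and is nonpositive. *)
Lemma ae_le0_integral P (D : set T) X : measurable D ->
  measurable_fun setT X -> (\forall w \ae P, D w -> X w <= 0) ->
  (\int[P]_(w in D) (X w)%:E <= 0)%E.
Proof.
move=> mD mX X0.
have mX' : measurable_fun D (EFin \o X).
  by apply/measurable_EFinP; exact: measurable_funTS.
rewrite (@ae_eq_integral _ _ _ _ _ (fun w => - `|(X w)%:E|)%E)//.
- by rewrite integral_ge0N// leeNl oppe0 integral_ge0.
- by do 2 apply: measurableT_comp => //.
- by apply: filterS X0 => w X0 Dw; rewrite lee0_abs ?oppeK// lee_fin X0.
Qed.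

Lemma ae_ge0_integral_le0 P (D : set T) X : measurable D ->
  measurable_fun setT X -> (\forall w \ae P, 0 <= X w) ->
  (\int[P]_(w in D) (X w)%:E <= 0)%E -> \forall w \ae P, D w -> X w = 0.
Proof.
move=> mD mX X0; rewrite integral_abs_ae_ge0// => iX.
have mX' : measurable_fun D (EFin \o X).
  by apply/measurable_EFinP; exact: measurable_funTS.
have /(ae_eq_integral_abs P mD mX') : (\int[P]_(w in D) `|(X w)%:E|)%E = 0%E.
  by apply/eqP; rewrite eq_le iX integral_ge0.
by apply: filterS => w + Dw => /(_ Dw) [].
Qed.

End probability.

(** * Versions of conditional expectations *)

Section conditional_expectation.
Context (d : measure_display) (T : measurableType d) (R : realType).
Context (P : probability T R) (G : set (set T)).
Hypothesis Gm : G `<=` measurable.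
Implicit Types X Y : T -> R.

Lemma is_condE_id X : P.-integrable setT (EFin \o X) -> measurable_wrt G X ->
  is_condE P G X X.
Proof. by []. Qed.

(** [G] need not contain the null sets, so measurability of [Y'] with respect to [G] does not follow
    from that of [Y] and is assumed. *)
Lemma is_condE_ae X X' Y Y' :
  measurable_fun setT X' -> measurable_wrt G Y' ->
  (\forall w \ae P, X w = X' w) -> (\forall w \ae P, Y w = Y' w) ->
  is_condE P G X Y -> is_condE P G X' Y'.
Proof.
move=> mX' mY' XX' YY' [iX iY mY XY].
have mY'T := measurable_wrt_fun Gm mY'.
have mYT := measurable_wrt_fun Gm mY.
have /integrableP[/measurable_EFinP mX _] := iX.
split=> //; [exact: ae_integrable iX|exact: ae_integrable iY|move=> A GA].
have mA := Gm GA.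
have := XY A GA.
rewrite (@ae_eq_integral _ _ _ _ _ (EFin \o Y) (EFin \o Y')) //; last 3 first.
- by apply/measurable_EFinP; exact: measurable_funTS.
- by apply/measurable_EFinP; exact: measurable_funTS.
- by apply: filterS YY' => w /= -> _.
rewrite (@ae_eq_integral _ _ _ _ _ (EFin \o X) (EFin \o X')) //.
- by apply/measurable_EFinP; exact: measurable_funTS.
- by apply/measurable_EFinP; exact: measurable_funTS.
- by apply: filterS XX' => w /= -> _.
Qed.

Lemma is_condE_sub X X' Y Y' : is_condE P G X Y -> is_condE P G X' Y' ->
  is_condE P G (fun w => X w - X' w) (fun w => Y w - Y' w).
Proof.
move=> [iX iY mY XY] [iX' iY' mY' XY']; split.
- by have := integrableB measurableT iX iX'; apply: eq_integrable.
- by have := integrableB measurableT iY iY'; apply: eq_integrable.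
- exact: measurable_funB.
- move=> A GA; have mA := Gm GA.
  have iS Z : P.-integrable setT (EFin \o Z) -> P.-integrable A (EFin \o Z).
    exact: integrableS.
  by rewrite !integralB_EFin; rewrite ?XY ?XY'//; exact: iS.
Qed.

(** Convexity yields a member of the family that agrees with a mixture on measurable sets only;
    integrals over measurable sets see no more than that. *)
Lemma is_condE_eq_measure (Q : probability T R) X Y :
  (forall A, measurable A -> P A = Q A) ->
  is_condE P G X Y -> is_condE Q G X Y.
Proof.
move=> PQ [iX iY mY XY].
have eqi A h : measurable A -> (\int[P]_(w in A) h w = \int[Q]_(w in A) h w)%E.
  by move=> mA; apply: eq_measure_integral => B mB _; exact: PQ.
have int h : P.-integrable setT h -> Q.-integrable setT h.
  by move=> /integrableP[mh ih]; apply/integrableP; split=> //; rewrite -eqi.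
split=> //; [exact: int|exact: int|move=> A GA].
by rewrite -!eqi; [exact: XY|exact: Gm..].
Qed.

End conditional_expectation.

(** * Finite mixtures inside a convex family *)

Section mixtures.
Context (d : measure_display) (T : measurableType d) (R : realType).
Context (M : set (probability T R)).

(** Induction on [n]: the weights after the first are renormalised by their sum [s], and the
    resulting measure is mixed with [Q ord0]. *)
Lemma convex_family_sum n (c : 'I_n -> R) (Q : 'I_n -> probability T R) :
  convex_family M -> (forall i, M (Q i)) -> (forall i, 0 <= c i) ->
  \sum_(i < n) c i = 1 ->
  exists2 N, M N &
    forall A, measurable A -> N A = (\sum_(i < n) (c i)%:E * Q i A)%E.
Proof.
move=> cM; elim: n c Q => [|n IH] c Q MQ c0.
  by rewrite big_ord0 => /esym/eqP; rewrite oner_eq0.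
rewrite big_ord_recl; set s := \sum_(i < n) _ => cs.
have s0 : 0 <= s by exact: sumr_ge0.
have cE : c ord0 = 1 - s by rewrite -cs addrK.
(* If [s] is 0, renormalising is impossible, but then all the weight sits on [Q ord0]. *)
have [s00|s_neq0] := eqVneq s 0.
  exists (Q ord0) => // A mA; rewrite big_ord_recl cE s00 subr0 mul1e.
  rewrite big1 ?adde0// => i _.
  have /eqP := s00; rewrite psumr_eq0// => /allP/(_ i).
  by rewrite mem_index_enum => /(_ isT)/eqP ->; rewrite mul0e.
have [|//||N MN NE] :=
    IH (fun i => c (lift ord0 i) / s) (fun i => Q (lift ord0 i)).
- by move=> i.
- by move=> i; rewrite divr_ge0.
- by rewrite -mulr_suml mulfV.
have [|K MK KE] := cM (Q ord0) N (c ord0) (MQ _) MN.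
  by rewrite c0/= cE gerBl.
exists K => // A mA; rewrite KE// NE// big_ord_recl; congr (_ + _)%E.
rewrite cE opprB addrC subrK ge0_sume_distrr; last first.
  by move=> i _; rewrite mule_ge0// lee_fin divr_ge0.
by apply: eq_bigr => i _; rewrite muleA -EFinM mulrC divfK.
Qed.

Lemma mixture_mem n (Q : 'I_n -> probability T R) P :
  convex_family M -> (forall i, M (Q i)) -> mixtures Q P ->
  exists2 N, M N & forall A, measurable A -> N A = P A.
Proof.
move=> cM MQ [c [c0 c1 PE]].
have [N MN NE] := convex_family_sum cM MQ c0 c1.
by exists N => // A mA; rewrite NE// PE.
Qed.

End mixtures.

(** * A common lower bound for finitely many conditional expectations *)

Section common_lower_bound.
Context (d : measure_display) (T : measurableType d) (R : realType).
Context (G : set (set T)).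
Hypothesis sG : sigma_algebra setT G.
Hypothesis Gm : G `<=` measurable.

Lemma measurable_wrt_le0 (X : T -> R) :
  measurable_wrt G X -> G [set w | X w <= 0].
Proof.
move=> /(_ measurableT `]-oo, 0]%classic (measurable_itv _)).
(* [G] is a sigma-algebra, so it coincides with the one it generates. *)
rewrite /measurable/= sigma_algebra_id// setTI => GX.
by rewrite (_ : [set w | _] = X @^-1` `]-oo, 0]%classic)//; apply/seteqP;
  split=> w /=; rewrite in_itv.
Qed.

Lemma measurable_wrt_bigmin n (D : 'I_n -> T -> R) :
  (forall i, measurable_wrt G (D i)) ->
  measurable_wrt G (fun w => \big[Num.min/1]_(i < n) Num.max 0 (D i w)).
Proof.
move=> mD; rewrite /measurable_wrt.
elim: (index_enum _) => [|i s IH].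
  by under eq_fun do rewrite big_nil; exact: measurable_cst.
under eq_fun do rewrite big_cons.
apply: measurable_minr => //; apply: measurable_maxr => //; exact: mD.
Qed.

(* The set where E^{Q_i}[X | G] vanishes is the largest set of G on which X
   vanishes almost surely, hence does not depend on i up to null sets; so the
   minimum of the finitely many conditional expectations stays positive. *)
Lemma condE_common_lower_bound n (Q : 'I_n.+1 -> probability T R)
    (X : T -> R) (D : 'I_n.+1 -> T -> R) :
  (forall i j, Q i `<< Q j) ->
  (forall i, \forall w \ae Q i, 0 <= X w) ->
  ~ (\forall w \ae Q ord0, X w = 0) ->
  (forall i, is_condE (Q i) G X (D i)) ->
  (forall i, \forall w \ae Q i, 0 <= D i w) ->
  exists phi : T -> R,
    [/\ measurable_wrt G phi, forall w, 0 <= phi w,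
        (0 < Q ord0 [set w | (0 < phi w)%R])%E
      & forall i, \forall w \ae Q i, phi w <= D i w].
Proof.
move=> QQ X0 nX0 XD D0.
(* Truncation at 0 makes [phi] nonnegative everywhere; the default 1 is positive, so [phi] vanishes
   only where some [D i] is nonpositive. *)
pose phi w := \big[Num.min/1]_(i < n.+1) Num.max 0 (D i w).
have mD i : measurable_wrt G (D i) by case: (XD i).
have mphi : measurable_wrt G phi by exact: measurable_wrt_bigmin.
exists phi; split=> // [w| |i].
- by apply/bigmin_geP; split=> // i _; rewrite le_max lexx.
- rewrite lt0e measure_ge0 andbT; apply/eqP => Qphi; apply: nX0.
  have mpos : measurable [set w | 0 < phi w].
    rewrite (_ : [set w | _] = ~` [set w | phi w <= 0]).
      by apply: measurableC; apply: Gm; exact: measurable_wrt_le0.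
    by apply/seteqP; split=> w /=; rewrite real_ltNge ?num_real// => /negP.
  have phi0 : \forall w \ae Q ord0, phi w <= 0.
    exists [set w | 0 < phi w]; split=> // w /=.
    by rewrite real_ltNge ?num_real// => /negP.
  (* The set where [D i] is nonpositive belongs to [G], so the integral of [X] over it equals that
     of [D i] and is nonpositive, while [X] is nonnegative. *)
  have XD0 i : \forall w \ae Q ord0, D i w <= 0 -> X w = 0.
    apply: (ae_dominates (QQ ord0 i)).
    have GA := measurable_wrt_le0 (mD i).
    have [/integrableP[/measurable_EFinP mX _] iD _ XDE] := XD i.
    apply: ae_ge0_integral_le0 => //; first exact: Gm.
    rewrite -XDE//; apply: ae_le0_integral; [exact: Gm| |exact: aeW].
    exact: measurable_wrt_fun (mD i).
  have := ae_all_ord XD0; move: phi0; apply: filterS2 => w + XD0w.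
  move=> /bigmin_leP[|[i _]]; first by rewrite real_leNgt ?num_real// ltr01.
  by rewrite ge_max lexx => /XD0w.
- apply: filterS (D0 i) => w Dw.
  by apply: (bigmin_inf i) => //; rewrite ge_max Dw lexx.
Qed.

End common_lower_bound.

(** * Adapted processes, stopping and maximal compensators *)

Section process.
Context (d : measure_display) (T : measurableType d) (R : realType).
Context (F : nat -> set (set T)).
Hypothesis HF : is_filtration F.
Implicit Types (M : set (probability T R)) (f g h : nat -> T -> R).

Let F0 : F 0%N = [set set0; setT]. Proof. by case: HF. Qed.
Let Fs m : sigma_algebra setT (F m). Proof. by case: HF. Qed.
Let Fm m : F m `<=` measurable. Proof. by case: HF. Qed.

Lemma filtration_le k m : (k <= m)%N -> F k `<=` F m.
Proof.
move=> km; rewrite -(subnKC km); elim: (m - k)%N => [|n IH]; first by rewrite addn0.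
by rewrite addnS; apply: subset_trans IH _; case: HF.
Qed.

Lemma adapted_le f k m :
  adapted F f -> (k <= m)%N -> measurable_wrt (F m) (f k).
Proof. by move=> af km; exact: measurable_wrtS (filtration_le km) (af k). Qed.

Lemma adapted_fun f m : adapted F f -> measurable_fun setT (f m).
Proof. by move=> af; exact: measurable_wrt_fun (@Fm m) (af m). Qed.

Lemma adapted_stopped f N : adapted F f -> adapted F (fun m => f (minn m N)).
Proof. by move=> af m; apply: adapted_le => //; exact: geq_minl. Qed.

(** The case k = m of the conditional clause covers index 0 too, whereas the moment clause starts at
    1. *)
Lemma supermartingale_integrable M f P m :
  is_supermartingale F M f -> M P -> P.-integrable setT (EFin \o f m).
Proof. by move=> [_ _ fM] MP; have [Y []] := fM P MP m m (leqnn m). Qed.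

Lemma martingale_integrable M f P m :
  is_martingale F M f -> M P -> P.-integrable setT (EFin \o f m).
Proof. by move=> [_ _ fM] MP; have [] := fM P MP m m (leqnn m). Qed.

(** The stopping time is a constant: from [N] on the process is frozen at [f N], already measurable
    at time [k]; for [k] below [N] the inequality is that of [f] between [k] and the minimum of [m]
    and [N]. *)
Lemma supermartingale_stopped M f N :
  is_supermartingale F M f -> is_supermartingale F M (fun m => f (minn m N)).
Proof.
move=> fM; have [af _ cf] := fM; split=> [|P MP m _|P MP k m km].
- exact: adapted_stopped.
- by apply: expectation_abs_lty; exact: supermartingale_integrable MP.
- have [Nk|kN] := leqP N k.
    rewrite (minn_idPr _) ?(leq_trans Nk)//; exists (f N); last exact: aeW.
    by apply: is_condE_id; [exact: supermartingale_integrable MP|exact: adapted_le].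
  by apply: cf => //; rewrite leq_min km ltnW.
Qed.

Lemma martingale_stopped M f N :
  is_martingale F M f -> is_martingale F M (fun m => f (minn m N)).
Proof.
move=> fM; have [af _ cf] := fM; split=> [|P MP m _|P MP k m km].
- exact: adapted_stopped.
- by apply: expectation_abs_lty; exact: martingale_integrable MP.
- have [Nk|kN] := leqP N k.
    rewrite (minn_idPr _) ?(leq_trans Nk)//.
    by apply: is_condE_id; [exact: martingale_integrable MP|exact: adapted_le].
  by apply: cf => //; rewrite leq_min km ltnW.
Qed.

(* A compensator h dominating g satisfies E(f_m + h_m) <= f_0 = E(f_m + g_m). *)
Lemma martingale_compensator_maximal M f g h :
  (forall P, M P -> forall m,
    is_condE P (F 0) (fun w => f m w + g m w) (fun w => f 0 w + g 0 w)) ->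
  (forall w, g 0%N w = 0) -> compensators F M f h ->
  process_le M g h -> process_le M h g.
Proof.
move=> fg g0 [[_ h0 _] [_ _ fh]] gh m P MP.
have FT : F 0 setT by rewrite F0; right.
have [Y fhY Yle] := fh P MP 0%N m (leq0n m).
have := is_condE_sub (@Fm 0) fhY (fg P MP m).
(* [X] is [h m - g m], nonnegative almost surely; integrating over the whole space, a set of [F 0],
   shows that its mean is nonpositive. *)
set X := fun w => _ => -[iX _ _ /(_ setT FT) XE].
have XhgE w : X w = h m w - g m w by rewrite /X opprD addrACA subrr add0r.
have mX : measurable_fun setT X by case/integrableP: iX => /measurable_EFinP.
have : \forall w \ae P, setT w -> X w = 0.
  apply: ae_ge0_integral_le0 => //.
    by apply: filterS (gh m P MP) => w; rewrite XhgE subr_ge0.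
  rewrite -XE; apply: ae_le0_integral => //.
    apply: measurable_funB; apply: (measurable_wrt_fun (@Fm 0)).
      by case: fhY.
    by case: (fg P MP m).
  (* Both compensators start at 0, so [f 0 + g 0] and [f 0 + h 0] coincide. *)
  apply: filterS Yle => w Yle _.
  by rewrite subr_le0 g0 -(h0 w).
by apply: filterS => w /(_ Logic.I) /eqP; rewrite XhgE subr_eq0 => /eqP ->.
Qed.

(** * Regularity from a decomposition into a martingale and an increasing process *)

Section decomposition.
Context (M : set (probability T R)) (f Mart g : nat -> T -> R).
Hypothesis fM : is_supermartingale F M f.
Hypothesis MartM : is_martingale F M Mart.
Hypothesis gM : nondecreasing_process F M g.
Hypothesis fE : forall m, as_family M (fun w => f m w = Mart m w - g m w).

Let af : adapted F f. Proof. by case: fM. Qed.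
Let ag : adapted F g. Proof. by case: gM. Qed.
Let afg k : measurable_wrt (F k) (fun w => f k w + g k w).
Proof. by apply: measurable_funD; [exact: af|exact: ag]. Qed.

Lemma decomposition_condE P k m : M P -> (k <= m)%N ->
  is_condE P (F k) (fun w => f m w + g m w) (fun w => f k w + g k w).
Proof.
move=> MP km; have [_ _ /(_ P MP k m km)] := MartM.
apply: is_condE_ae => //.
- exact: measurable_wrt_fun (@Fm m) (@afg m).
- by apply: filterS (fE m MP) => w ->; rewrite subrK.
- by apply: filterS (fE k MP) => w ->; rewrite subrK.
Qed.

(** Subtract [Y] and [g k] from the martingale identity for [f + g]; what remains of [f k + g k] is
    [f k - Y]. *)
Lemma decomposition_increment_condE P k m Y : M P -> (k <= m)%N ->
  is_condE P (F k) (f m) Y ->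
  is_condE P (F k) (fun w => g m w - g k w) (fun w => f k w - Y w).
Proof.
move=> MP km fY.
(* [g k] is the difference of the integrable [f k + g k] and [f k]. *)
have ig : P.-integrable setT (EFin \o g k).
  have [ifg _ _ _] := decomposition_condE MP (leqnn k).
  have := integrableB measurableT ifg (supermartingale_integrable k fM MP).
  by apply: eq_integrable => // w _ /=; rewrite -EFinB addrC addKr.
have := is_condE_sub (@Fm k) (is_condE_sub (@Fm k) (decomposition_condE MP km) fY)
  (is_condE_id ig (@ag k)).
congr is_condE; apply/funext => w.
- by rewrite (addrC (f m w)) addrK.
- by rewrite addrAC addrK.
Qed.

(** Meant for [N] the mixtures of a finite family in [M]: null sets and conditional expectations are
    carried over from a matching measure of [M]. *)
Lemma decomposition_compensator (N : set (probability T R)) :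
  (forall P, N P ->
    exists2 Q, M Q & forall A, measurable A -> Q A = P A) ->
  compensators F N f g.
Proof.
move=> NM.
have [_ g0 gnd] := gM.
have condN P k m : N P -> (k <= m)%N ->
    is_condE P (F k) (fun w => f m w + g m w) (fun w => f k w + g k w).
  move=> /NM[Q MQ QP] km.
  exact: is_condE_eq_measure (@Fm k) _ _ _ QP (decomposition_condE MQ km).
split; split=> // P NP.
- have [Q MQ QP] := NM P NP.
  by have [B [mB B0 AB]] := gnd Q MQ; exists B; split=> //; rewrite -QP.
- by move=> m _; apply: expectation_abs_lty; have [] := condN P m m NP (leqnn m).
- move=> k m km; exists (fun w => f k w + g k w); last exact: aeW.
  exact: condN.
Qed.

Lemma decomposition_regular m0 P0 :
  convex_family M -> equivalent_family M ->
  (exists (phi : T -> R) (C : R),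
    [/\ measurable_fun setT phi,
        forall m, as_family M (fun w => `|f m w| <= phi w)
      & forall P, M P -> ('E_P[phi] < C%:E)%E]) ->
  (1 <= m0)%N -> M P0 -> ~ (\forall w \ae P0, g m0 w = g m0.-1 w) ->
  is_regular F M f.
Proof.
move=> cM eM bf m0_gt0 MP0 gP0; split=> //.
have [_ g0 gnd] := gM.
(* The predecessor of 0 is 0, so [gbar 0] vanishes as required. *)
pose gbar m w := g m w - g m.-1 w.
have [_ _ cf] := fM.
have gbar_ge0 m : as_family M (fun w => 0 <= gbar m w).
  move=> P MP; apply: filterS (gnd P MP) => w gw.
  by rewrite subr_ge0; apply: gw; exact: leq_pred.
exists gbar; split=> //.
- by move=> m; apply: measurable_funB; [exact: ag|exact: adapted_le (leq_pred m)].
- by move=> w; rewrite /gbar subrr.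
- move=> P MP m _; have [Y fY _] := cf P MP m.-1 m (leq_pred m).
  have [igbar _ _ _] := decomposition_increment_condE MP (leq_pred m) fY.
  by rewrite unlock; exact: integrable_lty.
move=> n Q MQ _; split.
  (* With [Y i] a version of the conditional expectation of [f m0], the difference [f m0.-1 - Y i]
     is one for [gbar m0], and the common lower bound applies. *)
  have /choice[Y YP] i : exists Y, is_condE (Q i) (F m0.-1) (f m0) Y /\
      \forall w \ae Q i, Y w <= f m0.-1 w.
    by have [Y] := cf _ (MQ i) _ _ (leq_pred m0); exists Y.
  have [| | | | |phi [mphi phi0 Qphi phiD]] := @condE_common_lower_bound _ _ _
      (F m0.-1) (Fs _) (@Fm _) n Q (gbar m0) (fun i w => f m0.-1 w - Y i w).
  - by move=> i j; exact: eM.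
  - by move=> i; exact: gbar_ge0.
  - move=> gbar0; apply: gP0; apply: (ae_dominates (eM _ _ MP0 (MQ ord0))).
    by apply: filterS gbar0 => w /eqP; rewrite subr_eq0 => /eqP.
  - move=> i; have [fY _] := YP i.
    exact: (decomposition_increment_condE (MQ i) (leq_pred m0) fY).
  - by move=> i; have [_] := YP i; apply: filterS => w; rewrite subr_ge0.
  exists m0, phi; split=> //; first by move=> P MP; exact: aeW.
  by move=> i; exists (Y i) => //; have [] := YP i.
have NM := mixture_mem cM MQ.
have gG := decomposition_compensator NM.
(* The chain is grown from [g] alone, so that [g] is a member of it. *)
have [||G Gmax gsub] := @chain_sub_maximal_chain _ (process_le (mixtures Q))
    (compensators F (mixtures Q) f) [set g].
- by move=> _ ->.
- by move=> _ _ -> ->; left => m P _; exact: aeW.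
exists G, g; split=> //.
- split=> [|h Gh]; first exact: gsub.
  apply: martingale_compensator_maximal => //; last by case: Gmax => + _ _; exact.
  move=> P /NM[N MN NP] m.
  exact: is_condE_eq_measure (@Fm 0) _ _ _ NP (decomposition_condE MN (leq0n m)).
- by move=> i k m km _; exact: decomposition_condE.
(* The increment of [g] is [gbar m] itself, so one version serves both. *)
- move=> i m _; have [Y fY _] := cf _ (MQ i) m.-1 m (leq_pred m).
  by exists (fun w => f m.-1 w - Y w);
    exact: (decomposition_increment_condE (MQ i) (leq_pred m) fY).
Qed.

End decomposition.

End process.

(** * Domination of the stopped process, and localization *)

(** The stopped process only runs through [f 0], ..., [f N], so the sum of their absolute values
    dominates it; class F bounds each mean uniformly over [M]. *)
Lemma class_F_stopped_bound (d : measure_display) (T : measurableType d)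
    (R : realType) (M : set (probability T R)) (f : nat -> T -> R) (N : nat) :
  (forall m, measurable_fun setT (f m)) -> class_F M f ->
  exists (phi : T -> R) (C : R),
    [/\ measurable_fun setT phi,
        forall m, as_family M (fun w => `|f (minn m N) w| <= phi w)
      & forall P, M P -> ('E_P[phi] < C%:E)%E].
Proof.
move=> mf fF.
have /choice[c cP] m : exists c : R,
    forall P, M P -> ('E_P[fun w => `|f m w|%R] <= c%:E)%E.
  have := fF m; set s := ereal_sup _ => sy.
  have sub P : M P -> ('E_P[fun w => `|f m w|%R] <= s)%E.
    by move=> MP; apply: ereal_sup_ubound; exists P.
  (* The supremum is minus infinity when [M] is empty; the bound 0 then serves. *)
  case: s sy sub => [r _ sub|//|_ sub]; first by exists r.
  by exists 0 => P MP; apply: le_trans (sub P MP) _; rewrite leNye.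
(* The added 1 makes the bound strict. *)
exists (fun w => \sum_(i < N.+1) `|f i w|), (\sum_(i < N.+1) c i + 1); split.
- by apply: measurable_sum => i; exact: measurableT_comp.
- move=> m P MP; apply: aeW => w.
  have mN : (minn m N < N.+1)%N by rewrite ltnS geq_minr.
  rewrite (bigD1 (Ordinal mN))//= lerDl; exact: sumr_ge0.
- move=> P MP; apply: (@le_lt_trans _ _ (\sum_(i < N.+1) c i)%:E); last first.
    by rewrite lte_fin ltrDl.
  rewrite unlock; under eq_integral do rewrite -sumEFin.
  rewrite ge0_integral_sum//; last first.
    move=> i; apply/measurable_EFinP; exact: measurableT_comp.
  by rewrite -sumEFin; apply: lee_sum => i _; have := cP i P MP; rewrite unlock.
Qed.

Theorem theorem2p6 (d : measure_display) (T : measurableType d) (R : realType)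
    (F : nat -> set (set T)) (M : set (probability T R))
    (f Mart g0 : nat -> T -> R) :
  is_filtration F ->
  convex_family M ->
  equivalent_family M ->
  is_supermartingale F M f ->
  class_F M f ->
  is_martingale F M Mart ->
  (forall P, M P -> forall m, ('E_P[fun w => `|Mart m w|%R] < +oo)%E) ->
  nondecreasing_process F M g0 ->
  (forall m, as_family M (fun w => f m w = Mart m w - g0 m w)) ->
  ~ is_martingale F M f ->
  is_local_regular F M f.
Proof.
move=> HF cM eM fM fF MartM _ gM fE nfM; split=> //.
have af : adapted F f by case: fM.
have ag : adapted F g0 by case: gM.
(* If every increment of [g0] vanished almost surely, so would [g0], by induction from its value 0
   at time 0, and [f] would be a martingale. *)
have [m0 [m0_gt0 [P0 MP0 gP0]]] : exists m0, (1 <= m0)%N /\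
    exists2 P0, M P0 & ~ (\forall w \ae P0, g0 m0 w = g0 m0.-1 w).
  apply: contrapT => g_const; apply: nfM.
  have g_eq0 m P : M P -> \forall w \ae P, g0 m w = 0.
    move=> MP; elim: m => [|m]; first by apply: aeW; case: gM.
    have : \forall w \ae P, g0 m.+1 w = g0 m w.
      by apply: contrapT => gm; apply: g_const; exists m.+1; split=> //; exists P.
    by apply: filterS2 => w ->.
  split=> [//|P MP m _|P MP k m km].
    by apply: expectation_abs_lty; exact: (supermartingale_integrable m fM MP).
  have := decomposition_condE HF fM MartM gM fE MP km.
  have fgE n : \forall w \ae P, f n w + g0 n w = f n w.
    by apply: filterS (g_eq0 n P MP) => w ->; rewrite addr0.
  by apply: (is_condE_ae _ _ (af k) (fgE m) (fgE k)); [case: HF|exact: (adapted_fun HF m af)].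
(* Every stopping time is at least [m0], so the increment of [g0] at [m0] survives stopping. *)
exists (addn m0); split=> [s t|//|s].
- by rewrite ltn_add2l.
- exact: cvg_addnl.
have m0s : minn m0 (m0 + s) = m0 by apply/minn_idPl; exact: leq_addr.
have m0s' : minn m0.-1 (m0 + s) = m0.-1.
  by apply/minn_idPl; exact: leq_trans (leq_pred _) (leq_addr _ _).
apply: (decomposition_regular HF (supermartingale_stopped HF (m0 + s) fM)
  (martingale_stopped HF (m0 + s) MartM) _ _ cM eM _ m0_gt0 MP0
  (g := fun m => g0 (minn m (m0 + s)))).
- have [_ g00 gnd] := gM; split=> [|w|P MP].
    exact: (adapted_stopped HF (m0 + s) ag).
    by rewrite min0n.
  apply: filterS (gnd P MP) => w gw k m km; apply: gw.
  by rewrite leq_min geq_minr andbT (leq_trans (geq_minl _ _)).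
- by move=> m; exact: fE.
- by apply: class_F_stopped_bound => // m; exact: (adapted_fun HF m af).
- by rewrite m0s m0s'.
Qed.
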